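(* Let $R$ be an infinite principal ideal domain that is not a field and whose set of units is finite. Let $\mathcal{P}$ be the collection of prime elements of $R$. Then $\mathcal{P}$ is infinite if and only if $\mathcal{P}$ is dense in $M(R)$.
   Context: For $r\in R$ let $\sigma_r:=\{s\in R: \langle r\rangle+\langle s\rangle=R\}$, where $\langle r\rangle$ is the ideal generated by $r$. Write $R^0=R\setminus\{0\}$ and $\sigma_k^0=\sigma_k\setminus\{0\}$. The Macías space $M(R)$ is the set $R^0$ with the topology having basis $\{\sigma_k^0: k\in R^0\}$. *)

(* Defs.v *)
From HB Require Import structures.
From mathcomp Require Import all_boot all_algebra.
From mathcomp Require Import all_classical topology.

Set Implicit Arguments.
Unset Strict Implicit.
Unset Printing Implicit Defensive.

Import GRing.Theory.
Local Open Scope classical_set_scope.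
Local Open Scope ring_scope.

Section Ideals.
Variable R : idomainType.
Implicit Types (I J : set R) (p r s : R).

(* Arbitrary ideals: the predicates [idealr_closed] and [idealr] of
   [ring_quotient] only cover proper ideals. *)
Definition is_ideal I : Prop :=
  [/\ I 0, (forall x y, I x -> I y -> I (x + y))
    & (forall a x, I x -> I (a * x))].

Definition ideal_gen r : set R := smallest is_ideal [set r].

Definition ideal_add I J : set R := [set x + y | x in I & y in J].

Definition is_pid : Prop :=
  forall I, is_ideal I -> exists r, I = ideal_gen r.

Definition divides r s : Prop := exists a, s = a * r.

Definition prime_elements : set R :=
  [set p | [/\ p != 0, p \isn't a GRing.unit
    & forall a b, divides p (a * b) -> divides p a \/ divides p b]].

Definition sigma r : set R :=
  [set s | ideal_add (ideal_gen r) (ideal_gen s) = [set: R]].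

Lemma ideal_genE r : ideal_gen r = [set a * r | a in [set: R]].
Proof.
apply/seteqP; split=> [x|_ [a _ <-] I [[_ _ IM] Ir]].
  apply; split; last by move=> _ ->; exists 1; rewrite ?mul1r.
  split; first by exists 0; rewrite ?mul0r.
    by move=> _ _ [a _ <-] [b _ <-]; exists (a + b); rewrite ?mulrDl.
  by move=> a _ [b _ <-]; exists (a * b); rewrite ?mulrA.
exact/IM/Ir.
Qed.

Lemma sigmaP r s : sigma r s <-> exists a b, a * r + b * s = 1.
Proof.
rewrite /sigma /= !ideal_genE; split=> [E|[a [b E]]].
  have : [set: R] 1 by [].
  by rewrite -E => -[_ [a _ <-] [_ [b _ <-] ?]]; exists a, b.
apply/seteqP; split=> // x _.
exists (x * a * r); first by exists (x * a).
exists (x * b * s); first by exists (x * b).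
by rewrite -!mulrA -mulrDr E mulr1.
Qed.

Lemma sigma1 s : sigma 1 s.
Proof. by apply/sigmaP; exists 1, 0; rewrite mulr1 mul0r addr0. Qed.

Lemma sigmaM r s : sigma (r * s) = sigma r `&` sigma s.
Proof.
apply/seteqP; split=> t.
  move=> /sigmaP[a [b E]]; split; apply/sigmaP.
    by exists (a * s), b; rewrite -mulrA [s * r]mulrC.
  by exists (a * r), b; rewrite -mulrA.
move=> [/sigmaP[a [b E]] /sigmaP[c [d F]]]; apply/sigmaP.
exists (a * c), (a * r * d + b); rewrite -[RHS]E -[in RHS](mulr1 (a * r)) -F.
by rewrite mulrDr mulrDl addrA !mulrA (mulrAC a c r).
Qed.

End Ideals.

Arguments prime_elements R : clear implicits.

Record macias (R : idomainType) :=
  Macias { macias_val : R; macias_neq0 : macias_val != 0 }.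

Section Macias.
Variable R : idomainType.

HB.instance Definition _ := [isSub for @macias_val R].
HB.instance Definition _ := [Choice of macias R by <:].

Let one : macias R := Macias (oner_neq0 R).
HB.instance Definition _ := isPointed.Build (macias R) one.

Definition sigma0 (k : macias R) : set (macias R) :=
  [set s | sigma (val k) (val s)].

Let sigma0_cover : \bigcup_(k in [set: macias R]) sigma0 k = [set: macias R].
Proof. by apply/seteqP; split=> // s _; exists one => //; exact: sigma1. Qed.

Let sigma0_join (k l t : macias R) : [set: macias R] k -> [set: macias R] l ->
  sigma0 k t -> sigma0 l t ->
  exists m, [/\ [set: macias R] m, sigma0 m t & sigma0 m `<=` sigma0 k `&` sigma0 l].
Proof.
move=> _ _ kt lt.
have kl0 : val k * val l != 0 by rewrite mulf_neq0 ?(valP k) ?(valP l).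
exists (Macias kl0).
by split=> // [|s]; rewrite /sigma0 /= sigmaM.
Qed.

HB.instance Definition _ :=
  isBaseTopological.Build (macias R) sigma0_cover sigma0_join.

Lemma macias_openE (A : set (macias R)) :
  open A <-> exists K : set (macias R), A = \bigcup_(k in K) sigma0 k.
Proof.
by split=> [[K _ <-]|[K ->]]; [exists K | exists K].
Qed.

End Macias.

(* Main.v *)
(** A prime [p] lies in [sigma k] exactly when [p] does not divide [k]. If only
    finitely many primes exist, their product [k] gives a nonempty open set
    [sigma0 k] (it contains 1) without primes. Conversely, a nonzero [k] has
    only finitely many prime divisors: the divisors of [p k'] divide [p] or
    [k'], and those of [p] are its finitely many associates, so an element with
    infinitely many prime divisors would start an infinite strictly ascending
    chain of principal ideals. Hence an infinite set of primes meets every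
    [sigma0 k]. *)
Require Import Defs.
From mathcomp Require Import all_boot all_algebra.
From mathcomp Require Import all_classical topology.
Local Open Scope classical_set_scope.
Local Open Scope ring_scope.

Import GRing.Theory.

Section Divisibility.
Context {R : idomainType}.
Implicit Types a b d k p x y : R.

Lemma divides_trans y x z : divides x y -> divides y z -> divides x z.
Proof. by move=> [a ->] [b ->]; exists (b * a); rewrite mulrA. Qed.

Lemma ideal_gen_divides d x : ideal_gen d x <-> divides d x.
Proof.
rewrite ideal_genE; split=> [[a _ <-]|[a ->]]; first by exists a.
by exists a.
Qed.

Lemma dividesM_nunit k p : p * k != 0 -> p \isn't a GRing.unit ->
  ~ divides (p * k) k.
Proof.
move=> pk0 /negP pU [b kE]; apply: pU.
have k0 : k != 0 by apply: contraNneq pk0 => ->; rewrite mulr0.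
apply/unitrPr; exists b; apply: (mulIf k0).
by rewrite mul1r [p * b]mulrC -mulrA -kE.
Qed.

Lemma prime_divides_prod p (s : seq R) : p \in s -> divides p (\prod_(q <- s) q).
Proof.
move=> ps; exists (\prod_(q <- rem p s) q).
by rewrite (perm_big _ (perm_to_rem ps)) big_cons mulrC.
Qed.

Lemma sigma_divides_unit p k : sigma k p -> divides p k -> p \is a GRing.unit.
Proof.
move=> /sigmaP[a [b E]] [c kE]; apply/unitrPr; exists (a * c + b).
by rewrite mulrC mulrDl -mulrA -kE.
Qed.

(** With [p = a * d], primality makes [p] divide [d] or [a]; in the latter case cancelling [p]
    exhibits an inverse of [d]. *)
Lemma divides_prime d p : prime_elements R p -> divides d p ->
  d \is a GRing.unit \/ divides p d.
Proof.
move=> [p0 pU pP] [a pE].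
have /pP[[b aE]|] : divides p (a * d) by exists 1; rewrite mul1r -pE.
  left; apply/unitrPr; exists b; apply: (mulIf p0).
  by rewrite mul1r -mulrA -aE mulrC -pE.
by right.
Qed.

(** A prime [q] dividing [p] is not a unit, so [q = a * p], and cancelling [q] makes [a] a unit: all
    such [q] lie in the image of the units under multiplication by [p]. *)
Lemma finite_prime_divisors_prime p :
  finite_set [set u : R | u \is a GRing.unit] -> prime_elements R p ->
  finite_set [set q | prime_elements R q /\ divides q p].
Proof.
move=> finU pP; apply: sub_finite_set (finite_image (fun u => u * p) finU).
move=> q [[q0 qU qP] qp].
have [|[a qE]] := divides_prime q p pP qp; first by rewrite (negbTE qU).
have [b pE] := qp; exists a => //=; apply/unitrPr; exists b.
by apply: (mulIf q0); rewrite mul1r -mulrA -pE -qE.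
Qed.

End Divisibility.

Section PrincipalIdealDomain.
Context {R : idomainType}.
Hypothesis R_pid : is_pid R.

(** The union of the ascending ideals generated by the [k n] is principal; its generator already
    lies in one of them, and there the chain stops growing. *)
Lemma pid_acc (k : nat -> R) : (forall n, divides (k n.+1) (k n)) ->
  exists n, divides (k n) (k n.+1).
Proof.
move=> kS.
have kle m n : (m <= n)%N -> divides (k n) (k m).
  move=> /subnKC <-; elim: (n - m)%N => [|i IH].
    by rewrite addn0; exists 1; rewrite mul1r.
  by rewrite addnS; apply: divides_trans IH.
have [|d dE] := R_pid [set x | exists n, divides (k n) x].
  split=> [|x y [m mx] [n ny]|a x [n [b ->]]].
  - by exists 0%N, 0; rewrite mul0r.
  - exists (maxn m n).
    have [a ->] := divides_trans _ _ _ (kle _ _ (leq_maxl m n)) mx.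
    have [b ->] := divides_trans _ _ _ (kle _ _ (leq_maxr m n)) ny.
    by exists (a + b); rewrite mulrDl.
  - by exists n, (a * b); rewrite mulrA.
have [n nd] : [set x | exists n, divides (k n) x] d.
  by rewrite dE ideal_gen_divides; exists 1; rewrite mul1r.
exists n; apply: divides_trans nd _; apply/ideal_gen_divides; rewrite -dE.
by exists n.+1, 1; rewrite mul1r.
Qed.

(** The ideal generated by [k] and [p] has a generator [d] dividing both; [p] cannot divide [d], as
    it would then divide [k], so [d] is a unit. *)
Lemma prime_sigma (p k : R) :
  prime_elements R p -> ~ divides p k -> sigma k p.
Proof.
move=> pP pk.
have [|d dE] := R_pid [set x | exists a b, x = a * k + b * p].
  split=> [|_ _ [a [b ->]] [a' [b' ->]]|c _ [a [b ->]]].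
  - by exists 0, 0; rewrite !mul0r addr0.
  - by exists (a + a'), (b + b'); rewrite !mulrDl addrACA.
  - by exists (c * a), (c * b); rewrite mulrDr !mulrA.
have dk : divides d k.
  by apply/ideal_gen_divides; rewrite -dE; exists 1, 0; rewrite mul1r mul0r addr0.
have dp : divides d p.
  by apply/ideal_gen_divides; rewrite -dE; exists 0, 1; rewrite mul1r mul0r add0r.
have [dU|pd] := divides_prime d p pP dp; last by case: pk; apply: divides_trans dk.
have : ideal_gen d 1 by apply/ideal_gen_divides; exists d^-1; rewrite mulVr.
by rewrite -dE => -[a [b E]]; apply/sigmaP; exists a, b.
Qed.

Lemma finite_prime_divisors (k : R) :
  finite_set [set u : R | u \is a GRing.unit] -> k != 0 ->
  finite_set [set p | prime_elements R p /\ divides p k].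
Proof.
move=> finU k0; apply: contrapT => k_inf.
pose bad x := x != 0 /\ infinite_set [set p | prime_elements R p /\ divides p x].
(* Keeping [bad x] under the existential lets [choice] produce a total function; its value 0
   elsewhere is arbitrary. *)
have step x : exists y, bad x -> [/\ bad y, divides y x & ~ divides x y].
  have [[x0 x_inf]|] := pselect (bad x); last by exists 0.
  have [p [pP [y xE]]] := infinite_setN0 x_inf.
  rewrite mulrC in xE; have [p0 pU _] := pP.
  have y0 : y != 0 by apply: contraNneq x0 => yE; rewrite xE yE mulr0.
  exists y => _; split; last 2 first.
  - by exists p.
  - by rewrite xE; apply: dividesM_nunit; rewrite -?xE.
  split=> // y_fin; apply: x_inf.
  apply: (sub_finite_set _ (_ : finite_set (_ `|` _))); last first.
    by rewrite finite_setU; split; [exact: finite_prime_divisors_prime pP|exact: y_fin].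
  move=> q [qP]; rewrite xE => qpy.
  by have [_ _ /(_ _ _ qpy)[]] := qP; [left|right].
have [f fP] := choice step.
have badn n : bad (iter n f k) by elim: n => // n /fP[].
(* Iterating [f] from [k] gives a chain of proper divisors, which cannot stabilise. *)
have [n|n] := pid_acc (fun n => iter n f k).
  by have [_] := fP _ (badn n).
by have [_ _] := fP _ (badn n).
Qed.

End PrincipalIdealDomain.

Theorem theorem3p18 (R : idomainType)
  (R_infinite : infinite_set [set: R])
  (R_pid : is_pid R)
  (R_not_field : ~ GRing.field_axiom R)
  (R_units_finite : finite_set [set u : R | u \is a GRing.unit]) :
  infinite_set (prime_elements R) <->
  dense [set p : macias R | prime_elements R (val p)].
Proof.
split=> [P_inf O [x Ox] /macias_openE[K OE]|P_dense].
  move: Ox; rewrite OE => -[k Kk _].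
  have k_fin := finite_prime_divisors R_pid (val k) R_units_finite (valP k).
  have [p [pP pk]] : exists p, prime_elements R p /\ ~ divides p (val k).
    apply: contrapT => noP; apply: P_inf; apply: sub_finite_set k_fin => p pP.
    by split=> //; apply: contrapT => pk; apply: noP; exists p.
  have [p0 _ _] := pP; exists (Macias p0); split=> //.
  by exists k => //; apply: prime_sigma.
move=> /finite_seqP[s sE].
have k0 : \prod_(q <- s) q != 0.
  rewrite prodf_seq_neq0; apply/allP => q qs /=.
  by have [] : prime_elements R q by rewrite sE.
have [||p [kp pP]] := P_dense (sigma0 (Macias k0)).
- exists (Macias (oner_neq0 R)); apply/sigmaP; exists 0, 1.
  by rewrite mul0r mul1r add0r.
- by apply/macias_openE; exists [set Macias k0]; rewrite bigcup_set1.
(* The prime found in this open set is coprime to the product and yet divides it, so it would be a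
   unit. *)
have [_ /negP pU _] := pP; apply: pU; apply: sigma_divides_unit kp _.
by apply: prime_divides_prod; move: (pP : prime_elements R (val p)); rewrite sE.
Qed.
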